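(* Let $0<p\le\infty$, let $n\ge 2$, and let $K_n=(V,E)$ be the complete graph with $n$ vertices $V=\{a_1,a_2,\dots,a_n\}$. Then: (i) If $p>1$, then $\mathbf{C}_{K_n,p}=1-\frac1n$. (ii) If $0<p\le 1$ and $n=4$, then $\mathbf{C}_{K_n,p}=1-\frac1n$. (iii) If $n\ge 3$ and $\frac{\log 4}{\log 6}\le p\le 1$, then $\mathbf{C}_{K_n,p}=1-\frac1n$. Moreover, in all these cases the function $\delta_{a_2}$ is an extremizer, i.e. $\operatorname{Var}_p M_{K_n}\delta_{a_2}=\mathbf{C}_{K_n,p}\operatorname{Var}_p\delta_{a_2}$.
   Context: For a finite connected graph $G=(V,E)$, let $d_G(u,v)$ be the number of edges in a shortest path connecting $u$ and $v$, and let $B(e,r)=\{m\in V: d_G(e,m)\le r\}$. For $f:V\to\mathbb{R}$ the centered Hardy–Littlewood maximal function is $$M_Gf(e)=\max_{r\ge 0}\frac{1}{|B(e,r)|}\sum_{m\in B(e,r)}|f(m)|,\qquad e\in V.$$ For $0<p<\infty$ the $p$-variation of $f:V\to\mathbb{R}$ is $$\operatorname{Var}_p f=\Big(\frac12\sum_{u\in V}\ \sum_{v\in V:\, d_G(u,v)=1}|f(u)-f(v)|^p\Big)^{1/p},$$ and $\operatorname{Var}_\infty f=\max\{|f(u)-f(v)|: d_G(u,v)=1\}$. Define $$\mathbf{C}_{G,p}=\sup_{f:V\to\mathbb{R},\ \operatorname{Var}_pf>0}\frac{\operatorname{Var}_pM_Gf}{\operatorname{Var}_pf}.$$ The function $\delta_{a}:V\to\mathbb{R}$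 equals $1$ at $a$ and $0$ at all other vertices. *)

(* Defs.v *)
From HB Require Import structures.
From mathcomp Require Import all_boot all_order all_algebra.
From mathcomp Require Import all_classical all_reals all_analysis.

Set Implicit Arguments.
Unset Strict Implicit.
Unset Printing Implicit Defensive.

Import Order.TTheory GRing.Theory Num.Theory.

Local Open Scope classical_set_scope.
Local Open Scope ring_scope.

Record cgraph := CGraph {
  vertex :> finType;
  adj : rel vertex;
  adj_sym : symmetric adj;
  adj_irr : irreflexive adj;
  adj_conn : forall u v, connect adj u v
}.

Lemma walk_exists (G : cgraph) (u v : G) : exists k : nat,
  [exists s : k.-tuple G, path (@adj G) u s && (last u s == v)].
Proof.
have /connectP[s ps ->] := adj_conn u v.
by exists (size s); apply/existsP; exists (in_tuple s); rewrite ps eqxx.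
Qed.

(* [path] allows repeated vertices, which does not affect the minimum. *)
Definition dist (G : cgraph) (u v : G) : nat := ex_minn (walk_exists u v).

Definition gball (R : realType) (G : cgraph) (e : G) (r : R) : {set G} :=
  [set m | (dist e m)%:R <= r]%SET.

Definition ball_avg (R : realType) (G : cgraph) (f : G -> R) (e : G) (r : R) : R :=
  #|gball e r|%:R^-1 * \sum_(m in gball e r) `|f m|.

(* There are only finitely many balls around [e], so this supremum is a
   maximum: see [hl_max_attained] and [hl_max_ge]. *)
Definition hl_max (R : realType) (G : cgraph) (f : G -> R) (e : G) : R :=
  sup [set ball_avg f e r | r in [set r : R | 0 <= r]].

Lemma hl_max_max (R : realType) (G : cgraph) (f : G -> R) (e : G) :
  exists2 r0 : R, 0 <= r0 & hl_max f e = ball_avg f e r0 /\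
    forall r : R, 0 <= r -> ball_avg f e r <= ball_avg f e r0.
Proof.
pose P (B : {set G}) := `[< exists2 r : R, 0 <= r & gball e r = B >].
pose F (B : {set G}) : R := #|B|%:R^-1 * \sum_(m in B) `|f m|.
have P0 : P (gball e (0 : R)) by apply/asboolP; exists 0.
case: (arg_maxP F P0) => B /asboolP[r0 r0_ge0 <-] r0_max.
have r0_ub r : 0 <= r -> ball_avg f e r <= ball_avg f e r0.
  by move=> r_ge0; apply: r0_max; apply/asboolP; exists r.
exists r0 => //; split=> //; apply/eqP; rewrite eq_le; apply/andP; split.
  apply: ge_sup; first by exists (ball_avg f e r0), r0.
  by move=> _ [r /= r_ge0 <-]; exact: r0_ub.
apply: ub_le_sup; last by exists r0.
by exists (ball_avg f e r0) => _ [r /= r_ge0 <-]; exact: r0_ub.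
Qed.

Lemma hl_max_attained (R : realType) (G : cgraph) (f : G -> R) (e : G) :
  exists2 r : R, 0 <= r & hl_max f e = ball_avg f e r.
Proof. by have [r r_ge0 [hr _]] := hl_max_max f e; exists r. Qed.

Lemma hl_max_ge (R : realType) (G : cgraph) (f : G -> R) (e : G) (r : R) :
  0 <= r -> ball_avg f e r <= hl_max f e.
Proof. by have [r0 _ [-> hr]] := hl_max_max f e; exact: hr. Qed.

(* Only exponents [0 < p <= +oo] are meaningful. Since [0 `^ s = 0] for
   [s != 0], terms with [f u = f v] vanish for every finite [p > 0]. *)
Definition pvar (R : realType) (G : cgraph) (p : \bar R) (f : G -> R) : R :=
  match p with
  | r%:E => (2^-1 * \sum_(u : G) \sum_(v : G | dist u v == 1%N)
               `|f u - f v| `^ r) `^ r^-1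
  | +oo%E => \big[Num.max/0]_(uv : G * G | dist uv.1 uv.2 == 1%N)
               `|f uv.1 - f uv.2|
  | -oo%E => 0
  end.

(* The supremum is taken in [\bar R], so finiteness is part of any claim that
   it equals a real number. *)
Definition var_const (R : realType) (G : cgraph) (p : \bar R) : \bar R :=
  ereal_sup [set (pvar p (hl_max f) / pvar p f)%:E
            | f in [set f : G -> R | 0 < pvar p f]].

Definition delta (R : realType) (G : cgraph) (a : G) : G -> R :=
  fun x => (x == a)%:R.

Definition complete_adj (V : finType) : rel V := fun u v => u != v.

Lemma complete_adj_sym (V : finType) : symmetric (@complete_adj V).
Proof. by move=> u v; rewrite /complete_adj eq_sym. Qed.

Lemma complete_adj_irr (V : finType) : irreflexive (@complete_adj V).
Proof. by move=> u; rewrite /complete_adj eqxx. Qed.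

Lemma complete_adj_conn (V : finType) (u v : V) : connect (@complete_adj V) u v.
Proof. by have [->|uv] := eqVneq u v; [exact: connect0 | exact: connect1]. Qed.

Definition complete_graph (V : finType) : cgraph :=
  CGraph (@complete_adj_sym V) (@complete_adj_irr V) (@complete_adj_conn V).

(* Main.v *)
Require Import Defs.
From mathcomp Require Import all_boot all_order all_algebra.
From mathcomp Require Import all_classical all_reals all_analysis.
From mathcomp Require Import ring lra.

Set Implicit Arguments.
Unset Strict Implicit.
Unset Printing Implicit Defensive.

Import Order.TTheory GRing.Theory Num.Theory.

Local Open Scope ring_scope.

(** On a complete graph every ball is a point or the whole vertex set, so
    [hl_max f = max(|f|, m)] where [m] is the mean of [|f|].  With
    [g = |f| - m], a function of mean zero, [hl_max f] is the positive part
    [g^+] plus a constant, and [g] varies no more than [f].  The constant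
    [theta = 1 - 1/n] is thus an upper bound as soon as
    [Var_p g^+ <= theta * Var_p g] for all [g] of mean zero.  It is attained at
    a point mass, since [hl_max delta = theta * delta + 1/n].

    For [p = oo] it follows from [n * g u = sum_v (g u - g v)], a sum of at
    most [n - 1] non-zero oscillations ([pos_part_oscillation]).

    For finite [p] the pairs of vertices are sorted by the sign of [g].  The
    factor [theta^p] loses on pairs inside [{g > 0}], where [g] and [g^+] vary
    equally, and the pairs across the two signs have to compensate.  For
    [p >= 1] the function [x^p] lies above its tangents; the tangent at [g^+ u]
    bounds the gain of the pair [(u, v)] below by an expression linear in
    [g v], whose sum over [v] is known because [g] has mean zero
    ([pos_part_variation_convex]).

    For [p <= 1] the function [x^p] is concave and that bound points the wrong
    way.  Concavity is used instead to flatten the negative part [g^-]: it is a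
    positive combination of indicators of nested sets [T] such that the
    oscillations [|g^- u - g^- v|] decompose with the same weights
    ([layer_cake]).  Hence [g] is an average of functions [g^+ - s_T 1_T] of
    mean zero, each [|g u - g v|] is the average of their oscillations, and
    Jensen's inequality reduces the claim to [g^- = s 1_T]
    ([pos_part_variation_concave]).  In that case the gain of a crossing pair
    [(u, v)] depends on [g^+ u] alone and is estimated by a tangent of [x^p],
    while the crude bound [|g^+ u - g^+ v| <= sum g^+] controls the loss
    ([two_level_variation]). *)

(** * Tangent lines and Jensen's inequality for powers *)

(** Apply [ln x <= ln A + (x / A - 1)] at [x = t] and at [x = 1], with [A] the
    average of [t] and [1] for the weights [p] and [1 - p]. *)
Lemma powR_le_bernoulli (R : realType) (p t : R) :
  0 < p <= 1 -> 0 < t -> t `^ p <= 1 + p * (t - 1).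
Proof.
move=> /andP[p0 p1] t0; set A := 1 + _.
have A0 : 0 < A by rewrite /A; nra.
have lnA x : 0 < x -> ln x <= ln A + (x / A - 1).
  move=> x0; rewrite -lerBlDl -ln_div ?posrE//.
  have := @le_ln1Dx R (x / A - 1); rewrite [1 + _]addrC subrK; apply.
  by rewrite ltrBrDl subrr divr_gt0.
rewrite /powR gt_eqF// -[leRHS]lnK ?posrE// ler_expR.
have := lnA _ t0; have := lnA 1 ltr01; rewrite ln1 => h1 ht.
have e : p * (t / A - 1) + (1 - p) * (1 / A - 1) = 0.
  by rewrite /A; field; rewrite gt_eqF.
have : p * ln t + (1 - p) * 0 <=
    p * (ln A + (t / A - 1)) + (1 - p) * (ln A + (1 / A - 1)).
  by apply: lerD; rewrite ler_wpM2l// ?subr_ge0// ltW.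
lra.
Qed.

Lemma powR_le_tangent (R : realType) (p x y : R) :
  0 < p <= 1 -> 0 <= x -> 0 < y ->
  x `^ p <= y `^ p + p * y `^ (p - 1) * (x - y).
Proof.
move=> /andP[p0 p1]; rewrite le_eqVlt => /predU1P[<-|x0] y0.
  rewrite powR0 ?gt_eqF// sub0r mulrN -mulrA [_ * y]mulrC.
  by rewrite mulr_powRB1 ?(ltW y0)// subr_ge0 ler_piMl ?powR_ge0.
have := @powR_le_bernoulli R p (x / y); rewrite p0 p1 divr_gt0// => /(_ isT isT).
rewrite -(ler_pM2l (powR_gt0 p y0)) -powRM ?divr_ge0 ?(ltW x0) ?(ltW y0)//.
rewrite mulrCA divff ?gt_eqF// mulr1 => /le_trans; apply.
rewrite -(mulr_powRB1 (ltW y0) p0) le_eqVlt; apply/predU1P; left.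
by field; rewrite gt_eqF.
Qed.

(** The concave case for the exponent [p^-1], read off at the points [x^p] and
    [y^p]. *)
Lemma powR_ge_tangent (R : realType) (p x y : R) :
  1 <= p -> 0 <= x -> 0 < y ->
  y `^ p + p * y `^ (p - 1) * (x - y) <= x `^ p.
Proof.
move=> p1 x0 y0; have p0 : 0 < p by lra.
have := @powR_le_tangent R p^-1 (x `^ p) (y `^ p).
rewrite invr_gt0 p0 invf_le1//= p1 powR_ge0 powR_gt0// => /(_ isT isT isT).
rewrite -!powRrM mulfV ?gt_eqF// !powRr1 ?(ltW y0)//.
have -> : p * (p^-1 - 1) = - (p - 1) by field; rewrite gt_eqF.
rewrite powRN.
set c := y `^ (p - 1); have c0 : 0 < c by exact: powR_gt0.
rewrite -lerBlDl -(ler_pM2l (mulr_gt0 p0 c0)).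
have -> : p * c * (p^-1 / c * (x `^ p - y `^ p)) = x `^ p - y `^ p.
  by field; rewrite !gt_eqF.
lra.
Qed.

(** Averaging the tangent bound at the mean cancels the linear term. *)
Lemma powR_jensen (R : realType) (I : finType) (p : R) (w x : I -> R) :
  0 < p <= 1 -> (forall i, 0 <= w i) -> \sum_i w i = 1 ->
  (forall i, 0 <= x i) ->
  \sum_i w i * x i `^ p <= (\sum_i w i * x i) `^ p.
Proof.
move=> p01 w0 w1 x0; have /andP[p0 p1] := p01; set y := \sum_i w i * x i.
have wx0 i : 0 <= w i * x i by exact: mulr_ge0.
have : 0 <= y by exact: sumr_ge0.
rewrite le_eqVlt => /predU1P[/esym y0|y0].
  rewrite y0 powR0 ?gt_eqF// big1// => i _.
  have /eqP := psumr_eq0P (fun i _ => wx0 i) y0 (erefl : xpredT i).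
  by rewrite mulf_eq0 => /orP[]/eqP->; rewrite ?mul0r ?powR0 ?gt_eqF ?mulr0.
have -> : y `^ p =
    \sum_i w i * (y `^ p + p * y `^ (p - 1) * (x i - y)).
  under eq_bigr do rewrite mulrDr mulrCA mulrBr.
  rewrite big_split/= -mulr_suml w1 mul1r -mulr_sumr sumrB -mulr_suml w1.
  by rewrite mul1r subrr mulr0 addr0.
by apply: ler_sum => i _; rewrite ler_wpM2l// powR_le_tangent.
Qed.

(** * Decomposition of the oscillations of a function *)

(** Any function is [f^+ - f^-] with [f^+] and [f^-] never both positive;
    oscillations add up because, as [f] increases, the first grows and the
    second decreases. *)
Lemma normB_disjoint (R : realDomainType) (a b a' b' : R) :
  0 <= a -> 0 <= b -> a * b = 0 -> 0 <= a' -> 0 <= b' -> a' * b' = 0 ->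
  `|(a - b) - (a' - b')| = `|a - a'| + `|b - b'|.
Proof.
move=> a0 b0 /eqP ab a'0 b'0 /eqP ab'; move: ab ab'; rewrite !mulf_eq0.
case/orP=> /eqP ? /orP[]/eqP ?; subst; rewrite ?subr0 ?sub0r ?opprK ?normrN//.
- by rewrite !normr0 add0r distrC addrC.
- by rewrite -opprD normrN !ger0_norm ?addr_ge0 1?addrC.
- by rewrite !ger0_norm ?addr_ge0.
- by rewrite normr0 addr0.
Qed.

(** Subtracting the least positive value of [b] from [b] on its support [T0]
    preserves the order of the values, so the oscillations split as well, and
    it shrinks the support.  The sets carrying weight are therefore nested,
    which is what the last identity expresses. *)
Lemma layer_cake (R : realDomainType) (V : finType) (b : V -> R) :
  (forall v, 0 <= b v) ->
  exists w : {set V} -> R,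
  [/\ forall T, 0 <= w T,
      forall T, w T != 0 -> (0 < #|T|)%N /\ {in T, forall v, 0 < b v},
      forall v, b v = \sum_T w T * (v \in T)%:R
    & forall u v, `|b u - b v| =
        \sum_T w T * `|(u \in T)%:R - (v \in T)%:R|].
Proof.
pose supp (b : V -> R) := [set v | b v != 0].
have inS c v : (v \in supp c) = (c v != 0) by rewrite finset.in_set.
have [k] := ubnP #|supp b|; elim: k b => // k IHk b leb b0.
have [s0|[v0 v0s]] := set_0Vmem (supp b).
  have bE v : b v = 0 
    by apply/eqP; rewrite -[_ == _]negbK -inS s0 finset.in_set0.
  exists (fun=> 0); split=> // [T|v|u v]; first by rewrite eqxx.
    by rewrite bE big1// => T _; rewrite mul0r.
  by rewrite !bE subrr normr0 big1// => T _; rewrite mul0r.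
have [v1 v1s minv1] := @arg_minP _ R V v0 (mem (supp b)) b v0s.
pose T0 := supp b; pose m := b v1.
have {v1s} v1s : v1 \in T0 by exact: v1s.
have m0 : 0 < m by rewrite lt0r b0 andbT; rewrite -inS.
have bT v : v \in T0 -> 0 < b v by rewrite inS lt0r b0 andbT.
have bN v : v \notin T0 -> b v = 0 by rewrite inS negbK => /eqP.
pose b' v := b v - m * (v \in T0)%:R.
have b'0 v : 0 <= b' v.
  rewrite /b'; case: (boolP (v \in T0)) => vT; first by rewrite mulr1 subr_ge0 minv1.
  by rewrite mulr0 subr0.
have b'N v : v \notin T0 -> b' v = 0.
  by move=> vT; rewrite /b' (negbTE vT) mulr0 subr0 bN.
have b'lt v : 0 < b' v -> 0 < b v.
  move=> b'v; apply: bT; apply: contraT => /b'N b'v0.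
  by move: b'v; rewrite b'v0 ltxx.
have [|w [w0 wT wE wD]] := IHk b' _ b'0.
  rewrite -ltnS (leq_trans _ leb)// ltnS; apply: proper_card.
  apply/properP; split.
    by apply/fintype.subsetP => v; apply: contraTT => vT; rewrite inS b'N ?eqxx.
  by exists v1 => //; rewrite inS negbK /b' v1s mulr1 subrr.
exists (fun T => w T + m * (T == T0)%:R).
have sumE (F : {set V} -> R) :
    \sum_T (w T + m * (T == T0)%:R) * F T = \sum_T w T * F T + m * F T0.
  under eq_bigr do rewrite mulrDl.
  rewrite big_split/=; congr (_ + _).
  rewrite (bigD1 T0)//= eqxx mulr1 big1 ?addr0// => T /negbTE->.
  by rewrite mulr0 mul0r.
split.
- by move=> T; rewrite addr_ge0// mulr_ge0// ltW.
- move=> T; have [->|_] := eqVneq T T0.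
    by move=> _; split; [apply/card_gt0P; exists v0 | exact: bT].
  rewrite mulr0 addr0 => /wT[? h]; split=> // v /h; exact: b'lt.
- by move=> v; rewrite sumE -wE subrK.
- move=> u v; rewrite sumE -wD.
  case: (boolP (u \in T0)) => uT; case: (boolP (v \in T0)) => vT.
  + by rewrite subrr normr0 mulr0 addr0 /b' uT vT; congr `|_|; ring.
  + rewrite (b'N v)// (bN v)// !subr0 normr1 mulr1 !ger0_norm//.
    by rewrite /b' uT mulr1 subrK.
  + rewrite (b'N u)// (bN u)// !sub0r !normrN normr1 mulr1 !ger0_norm//.
    by rewrite /b' vT mulr1 subrK.
  + by rewrite !b'N// !bN// subrr normr0 mulr0 addr0.
Qed.

(** * Variation of the positive part of a mean-zero function *)

(** The factor 2 accounts for the two orders of a pair separated by [P]. *)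
Lemma double_sum_ge0 (R : realDomainType) (V : finType) (P : pred V)
    (H : V -> V -> R) :
  (forall u v, H u v = H v u) ->
  (forall u v, ~~ P u -> ~~ P v -> 0 <= H u v) ->
  0 <= \sum_(u | P u) \sum_(v | P v) H u v +
       2 * \sum_(u | P u) \sum_(v | ~~ P v) H u v ->
  0 <= \sum_u \sum_v H u v.
Proof.
move=> Hsym HN HP; rewrite (bigID P)/=.
have split_row u : \sum_v H u v = \sum_(v | P v) H u v + \sum_(v | ~~ P v) H u v.
  by rewrite (bigID P).
under eq_bigr do rewrite split_row.
under [X in _ + X]eq_bigr do rewrite split_row.
rewrite !big_split/= [X in _ + (X + _)]exchange_big/=.
under [X in _ + (X + _)]eq_bigr do under eq_bigr do rewrite Hsym.
have : 0 <= \sum_(u | ~~ P u) \sum_(v | ~~ P v) H u v.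
  by apply: sumr_ge0 => u Pu; apply: sumr_ge0 => v Pv; exact: HN.
lra.
Qed.

Lemma ler_npowR (R : realType) (r x y : R) :
  r <= 0 -> 0 < x -> x <= y -> y `^ r <= x `^ r.
Proof.
move=> r0 x0 xy; have y0 := lt_le_trans x0 xy.
rewrite -[r]opprK (powRN x (- r)) (powRN y (- r)) lef_pV2 ?posrE ?powR_gt0//.
by apply: ge0_ler_powR; rewrite ?nnegrE ?oppr_ge0 // ltW.
Qed.

(** The function [a - s 1_T] of mean zero has positive part [a].  Write
    [theta = 1 - 1/n], [S = sum a], [l = #|T|] and [k = n - l].
    Inside the complement of [T] the loss of a pair is at most
    [(1 - theta^p) S^p].  The gain of a crossing pair is
    [(theta (a u + s))^p - a u ^ p], to which the tangent at [theta (a u + s)]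
    applies; as [a u <= S], its slope is at least that at [theta (S + s)].
    After this the gain is linear in [a u], and summing it over [u] produces
    the factor [k - 1] that the loss also has.  As the tangent at [theta] gives
    [1 - theta^p <= p theta^(p-1) / n], what remains after division by common
    factors is [(k / n) S^(p-1) <= 2 (S + s)^(p-1)], true since
    [S + s <= 2 S]. *)
Lemma two_level_variation (R : realType) (V : finType) (p s : R) (a : V -> R)
    (T : {set V}) :
  0 < p <= 1 -> 0 < s -> (0 < #|T|)%N ->
  (forall v, 0 <= a v) -> (forall v, v \in T -> a v = 0) ->
  \sum_v a v = s * #|T|%:R ->
  \sum_u \sum_v `|a u - a v| `^ p <=
  (1 - #|V|%:R^-1) `^ p *
    \sum_u \sum_v (`|a u - a v| + s * `|(u \in T)%:R - (v \in T)%:R|) `^ p.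
Proof.
move=> p01 s0 T0 a0 aT aS; have /andP[p0 p1] := p01.
have nV : #|V| = (#|T| + #|[pred v | v \notin T]|)%N.
  by rewrite -(cardC (mem T)); congr (_ + _)%N; apply: eq_card.
have l1 : 1 <= #|T|%:R :> R by rewrite ler1n.
have S0 : 0 < s * #|T|%:R by rewrite mulr_gt0// (lt_le_trans _ l1).
have k1 : 1 <= #|[pred v | v \notin T]|%:R :> R.
  rewrite ler1n lt0n; apply/eqP => /card0_eq kE.
  move: S0; rewrite -aS big1 ?ltxx// => v _; apply: aT.
  by have := kE v; rewrite !inE => /negbFE.
have nE : #|V|%:R = #|T|%:R + #|[pred v | v \notin T]|%:R :> R.
  by rewrite nV natrD.
move: l1 S0 k1 aS nE.
set k : R := #|[pred v | v \notin T]|%:R; set l : R := #|T|%:R.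
set n : R := #|V|%:R; move=> l1 S0 k1 aS nE.
pose S := s * l; pose M := S + s; pose t := 1 - n^-1.
have n0 : 0 < n by lra.
have t0 : 0 < t by rewrite subr_gt0 invf_lt1//; lra.
have tn : t * n = n - 1 by rewrite /t; field; rewrite gt_eqF.
have M0 : 0 < M by rewrite /M /S; lra.
have sS : s <= S by rewrite ler_peMr// ltW.
have a_le v : a v <= S.
  by rewrite /S -aS (bigD1 v)//= lerDl sumr_ge0.
rewrite -subr_ge0 mulr_sumr -sumrB.
under eq_bigr do rewrite mulr_sumr -sumrB.
apply: (@double_sum_ge0 _ _ [pred v | v \notin T]) => /=.
- by move=> u v; rewrite (distrC (a u)) (distrC (u \in T)%:R).
- move=> u v; rewrite !negbK => uT vT.
  rewrite (aT u)// (aT v)// uT vT !subrr normr0 mulr0 addr0.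
  by rewrite powR0 ?gt_eqF// mulr0 subrr.
pose c := p * t `^ (p - 1).
have c0 : 0 <= c by rewrite mulr_ge0 ?powR_ge0// ltW.
(* Combines [M <= 2 S] with [1/2 <= 2^(p-1)]. *)
have SM : S `^ (p - 1) <= 2 * M `^ (p - 1).
  have h : (2 * S) `^ (p - 1) <= M `^ (p - 1).
    by apply: ler_npowR; rewrite ?subr_le0 // /M [2]mulr2n mulrDl mul1r lerD2l.
  have h2 : 2^-1 <= (2 : R) `^ (p - 1).
    by rewrite -powR_inv1// ler_powR ?ler1n// lerBrDl subrr ltW.
  rewrite powRM// ?(ltW S0)// in h.
  have := powR_ge0 S (p - 1); nra.
(* The tangent of [x^p] at [theta], which is [t] here, evaluated at 1. *)
have tp : 1 - t `^ p <= c / n.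
  have := powR_le_tangent p01 ler01 t0; rewrite powR1.
  have -> : c / n = p * t `^ (p - 1) * (1 - t) by rewrite /c -[n^-1](subKr 1).
  by rewrite lerBlDl.
(* The diagonal is discounted in order to obtain [k (k - 1)] rather than
   [k^2], which matters when [k = 1]. *)
have inT : \sum_(u | u \notin T) \sum_(v | v \notin T)
    (t `^ p * (`|a u - a v| + s * `|(u \in T)%:R - (v \in T)%:R|) `^ p
      - `|a u - a v| `^ p) >= - (c / n * (k * (k - 1) * S `^ p)).
  have -> : - (c / n * (k * (k - 1) * S `^ p)) =
      \sum_(u | u \notin T) \sum_(v | v \notin T)
         (- (c / n) * (S `^ p - (v == u)%:R * S `^ p)).
    under eq_bigr => u uT.
      rewrite -mulr_sumr sumrB sumr_const (bigD1 u)//= eqxx mul1r big1 ?addr0.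
        over.
      by move=> v /andP[_ /negbTE ->]; rewrite mul0r.
    rewrite sumr_const -mulr_natl -/k -mulr_natl -/k; ring.
  apply: ler_sum => u uT; apply: ler_sum => v vT.
  rewrite (negbTE uT) (negbTE vT) subrr normr0 mulr0 addr0.
  have [->|_] := eqVneq v u.
    by rewrite !subrr normr0 powR0 ?gt_eqF// mul1r subrr !mulr0 subrr.
  have d_le : `|a u - a v| `^ p <= S `^ p.
    apply: ge0_ler_powR; rewrite ?nnegrE ?(ltW p0) ?(ltW S0)//.
    rewrite ler_norml; have := a_le u; have := a_le v.
    by have := a0 u; have := a0 v; lra.
  rewrite mul0r subr0.
  have := ler_wpM2l (divr_ge0 c0 (ltW n0)) d_le.
  have := ler_wpM2r (powR_ge0 `|a u - a v| p) tp; lra.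
have outT : \sum_(u | u \notin T) \sum_(v | ~~ (v \notin T))
    (t `^ p * (`|a u - a v| + s * `|(u \in T)%:R - (v \in T)%:R|) `^ p
      - `|a u - a v| `^ p) >= c * M `^ (p - 1) * (l * (s * (k - 1))).
  have -> : c * M `^ (p - 1) * (l * (s * (k - 1))) =
      \sum_(u | u \notin T) \sum_(v | ~~ (v \notin T))
         c * M `^ (p - 1) * (t * s - a u / n).
    have aS' : \sum_(u | u \notin T) a u = s * l.
      by rewrite -aS [RHS](bigID [in T])/= [X in X + _]big1 ?add0r.
    under eq_bigr => u uT.
      rewrite (eq_bigl [in T]); last by move=> v; rewrite negbK.
      rewrite sumr_const -mulr_natl -/l; over.
    rewrite -!mulr_sumr sumrB sumr_const -mulr_suml aS' -mulr_natl -/k.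
    have -> : t = (n - 1) / n by rewrite -tn mulfK ?gt_eqF.
    by rewrite nE; field; rewrite -nE gt_eqF.
  apply: ler_sum => u uT; apply: ler_sum => v; rewrite negbK => vT.
  rewrite (negbTE uT) vT (aT v)// subr0 sub0r normrN normr1 mulr1.
  rewrite (ger0_norm (a0 u)) -powRM ?(ltW t0) ?addr_ge0 ?(ltW s0)//.
  have X0 : 0 < t * (a u + s) by rewrite mulr_gt0// ltr_wpDl.
  have := powR_le_tangent p01 (a0 u) X0.
  have XM : M `^ (p - 1) * t `^ (p - 1) <= (t * (a u + s)) `^ (p - 1).
    rewrite mulrC -powRM ?(ltW t0) ?(ltW M0)//; apply: ler_npowR => //.
      by rewrite subr_le0.
    by rewrite ler_pM2l// lerD2r.
  have e : t * (a u + s) - a u = t * s - a u / n by rewrite /t; ring.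
  (* Crossing pairs gain: [a u <= S = l s <= (n - 1) s]. *)
  have e0 : 0 <= t * s - a u / n.
    rewrite -(pmulr_lge0 _ n0) mulrBl divfK ?gt_eqF// mulrAC tn subr_ge0.
    by rewrite (le_trans (a_le u))// /S mulrC ler_pM2r//; lra.
  have : p * (M `^ (p - 1) * t `^ (p - 1)) * (t * s - a u / n) <=
      p * (t * (a u + s)) `^ (p - 1) * (t * s - a u / n).
    by rewrite ler_wpM2r// ler_wpM2l// ltW.
  rewrite -[a u - _]opprB e /c; lra.
apply: le_trans (lerD inT (ler_wpM2l (ler0n R 2) outT)).
have -> : S `^ p = S * S `^ (p - 1) by rewrite mulr_powRB1// ltW.
have kn : k / n <= 1 by rewrite ler_pdivrMr// mul1r; lra.
have : k / n * S `^ (p - 1) <= 2 * M `^ (p - 1).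
  by apply: le_trans SM; rewrite ler_piMl ?powR_ge0.
rewrite -subr_ge0 => h.
have : 0 <= c * S * (k - 1) * (2 * M `^ (p - 1) - k / n * S `^ (p - 1)).
  apply: mulr_ge0 h; apply: mulr_ge0; last by rewrite subr_ge0.
  by apply: mulr_ge0 => //; exact: ltW.
move: (S `^ (p - 1)) => Y; rewrite /S; lra.
Qed.

(** Decomposing [f^-] by [layer_cake] and distributing [f^+] with the weights
    [w T * #|T| / S], which sum to 1, gives two-level functions of mean zero
    with the same positive part as [f]. *)
Lemma pos_part_variation_concave (R : realType) (V : finType) (p : R)
    (f : V -> R) :
  0 < p <= 1 -> \sum_v f v = 0 ->
  \sum_u \sum_v `|Num.max (f u) 0 - Num.max (f v) 0| `^ p <=
  (1 - #|V|%:R^-1) `^ p * \sum_u \sum_v `|f u - f v| `^ p.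
Proof.
move=> p01 f0; have /andP[p0 p1] := p01.
pose a v := Num.max (f v) 0; pose b v := Num.max (- f v) 0.
have a0 v : 0 <= a v by rewrite le_max lexx orbT.
have b0 v : 0 <= b v by rewrite le_max lexx orbT.
have fE v : f v = a v - b v by rewrite /a /b; case: leP => ?; case: leP => ?; lra.
have ab v : a v * b v = 0.
  by rewrite /a /b; case: leP => ?; case: leP => ?; rewrite ?mulr0 ?mul0r//; lra.
pose S := \sum_v b v.
have aS : \sum_v a v = S.
  apply/eqP; rewrite -subr_eq0 /S -sumrB.
  by under eq_bigr do rewrite -fE; rewrite f0.
have normE u v : `|f u - f v| = `|a u - a v| + `|b u - b v|.
  by rewrite !fE normB_disjoint.
rewrite -[leLHS]/(\sum_u \sum_v `|a u - a v| `^ p).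
have [S0|S0] := eqVneq S 0.
  have aE v : a v = 0.
    exact: (psumr_eq0P (fun i _ => a0 i) (etrans aS S0) (erefl : xpredT v)).
  rewrite big1 ?mulr_ge0 ?powR_ge0// => [|u _].
    by apply: sumr_ge0 => u _; apply: sumr_ge0 => v _; exact: powR_ge0.
  by rewrite big1// => v _; rewrite !aE subrr normr0 powR0 ?gt_eqF.
have {}S0 : 0 < S by rewrite lt0r S0 sumr_ge0.
have [w [w0 wT wE wD]] := layer_cake b0.
pose lam T := w T * #|T|%:R / S.
have lam0 T : 0 <= lam T by rewrite !mulr_ge0 ?invr_ge0// ltW.
have lam1 : \sum_T lam T = 1.
  rewrite -mulr_suml -[RHS](divff (lt0r_neq0 S0)); congr (_ / _).
  rewrite /S; under [RHS]eq_bigr do rewrite wE.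
  rewrite exchange_big/=; apply: eq_bigr => T _.
  by rewrite -mulr_sumr -natr_sum -sum1_card big_mkcond.
pose s (T : {set V}) : R := S / #|T|%:R.
pose e (T : {set V}) u v : R := `|a u - a v| + s T * `|(u \in T)%:R - (v \in T)%:R|.
have s0 T : 0 <= s T by rewrite divr_ge0// ltW.
have e0 T u v : 0 <= e T u v by rewrite addr_ge0// mulr_ge0.
have eE u v : `|f u - f v| = \sum_T lam T * e T u v.
  rewrite normE /e; under eq_bigr do rewrite mulrDr.
  rewrite big_split/= -mulr_suml lam1 mul1r wD; congr (_ + _).
  apply: eq_bigr => T _; have [wT0|wT0] := eqVneq (w T) 0.
    by rewrite /lam wT0 !mul0r.
  have [T0 _] := wT _ wT0; rewrite mulrA; congr (_ * _).
  by rewrite /lam /s; field; rewrite pnatr_eq0 -lt0n T0 gt_eqF.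
have two T : lam T * \sum_u \sum_v `|a u - a v| `^ p <=
    lam T * ((1 - #|V|%:R^-1) `^ p * \sum_u \sum_v e T u v `^ p).
  have [wT0|wT0] := eqVneq (w T) 0; first by rewrite /lam wT0 !mul0r.
  have [T0 bT] := wT _ wT0.
  have lT : 0 < #|T|%:R :> R by rewrite ltr0n.
  apply: ler_wpM2l => //; apply: two_level_variation => //.
  - exact: divr_gt0.
  - move=> v /bT bv; apply/eqP; have /eqP := ab v.
    by rewrite mulf_eq0 (gt_eqF bv) orbF.
  - by rewrite divfK ?gt_eqF.
rewrite -[leLHS]mul1r -{1}lam1 mulr_suml.
apply: le_trans (ler_sum _ (fun T _ => two T)) _.
under eq_bigr do rewrite mulrCA.
rewrite -mulr_sumr ler_wpM2l ?powR_ge0//.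
under eq_bigr do rewrite mulr_sumr.
rewrite exchange_big/=; apply: ler_sum => u _.
under eq_bigr do rewrite mulr_sumr.
rewrite exchange_big/=; apply: ler_sum => v _.
by rewrite eE; apply: powR_jensen.
Qed.

(** With [a = f^+], [A = sum a^p] and [k] the number of positive values of [f],
    the pairs inside [{f > 0}] lose at most [(p / n) * 2 (k - 1) A], because
    [1 - theta^p <= p / n] and [|x - y|^p <= x^p + y^p].  The pairs [(u, v)]
    across the signs with [f u > 0] gain at least half of this, by the tangent
    of [x^p] at [a u] and since [a u] is at most the sum of the positive
    values; the reversed pairs gain the other half. *)
Lemma pos_part_variation_convex (R : realType) (V : finType) (p : R)
    (f : V -> R) :
  1 <= p -> (1 < #|V|)%N -> \sum_v f v = 0 ->
  \sum_u \sum_v `|Num.max (f u) 0 - Num.max (f v) 0| `^ p <=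
  (1 - #|V|%:R^-1) `^ p * \sum_u \sum_v `|f u - f v| `^ p.
Proof.
move=> p1 V2 f0; have p0 : 0 < p by lra.
have [P PE] : {P : pred V | forall v, P v = (0 < f v)} by exists (fun v => 0 < f v).
pose a v := Num.max (f v) 0.
have a0 v : 0 <= a v by rewrite le_max lexx orbT.
have aP v : P v -> a v = f v by rewrite PE => fv; apply/max_idPl; exact: ltW.
have aN v : ~~ P v -> a v = 0 by rewrite PE -leNgt => fv; apply/max_idPr.
have af v : f v <= a v by rewrite le_max lexx.
rewrite -[leLHS]/(\sum_u \sum_v `|a u - a v| `^ p).
have nE : #|V|%:R = #|P|%:R + #|[predC P]|%:R :> R by rewrite -natrD cardC.
have n2 : 2 <= #|V|%:R :> R by rewrite ler_nat.
move: nE n2; set k : R := #|P|%:R; set l : R := #|[predC P]|%:R.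
set n : R := #|V|%:R => nE n2.
pose t := 1 - n^-1; have n0 : 0 < n by lra.
have tn : t * n = n - 1 by rewrite /t; field; rewrite gt_eqF.
have t0 : 0 < t by rewrite -(pmulr_lgt0 _ n0) tn; lra.
pose S := \sum_(v | P v) f v.
have sumP c : \sum_(v | P v) c = k * c.
  by rewrite /k mulr_natl -sumr_const.
have sumN c : \sum_(v | ~~ P v) c = l * c.
  by rewrite /l mulr_natl -sumr_const.
have NS : \sum_(v | ~~ P v) f v = - S.
  by apply/eqP; rewrite -addr_eq0 addrC; move: f0; rewrite (bigID P)/= => ->.
have a_le v : P v -> a v <= S.
  move=> Pv; rewrite /S (bigD1 v)//= aP// lerDl sumr_ge0// => u /andP[].
  by rewrite PE => /ltW.
rewrite -subr_ge0 mulr_sumr -sumrB.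
under eq_bigr do rewrite mulr_sumr -sumrB.
pose A := \sum_(v | P v) a v `^ p.
have tp : 1 - t `^ p <= p / n.
  have := powR_ge_tangent p1 (ltW t0) ltr01; rewrite !powR1 mulr1.
  by rewrite /t; lra.
have tp0 : 0 <= 1 - t `^ p.
  rewrite subr_ge0 -(powRr0 t) ger_powR ?t0 ?(ltW p0)//.
  by rewrite /t gerBl invr_ge0 ltW.
apply: (@double_sum_ge0 _ _ P) => /=.
- by move=> u v; rewrite (distrC (f u)) (distrC (a u)).
- move=> u v uN vN; rewrite (aN u)// (aN v)// subrr normr0.
  by rewrite powR0 ?gt_eqF// subr0 mulr_ge0 ?powR_ge0.
have inP : \sum_(u | P u) \sum_(v | P v)
    (t `^ p * `|f u - f v| `^ p - `|a u - a v| `^ p) >=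
    - (p / n * (2 * (k - 1) * A)).
  have -> : - (p / n * (2 * (k - 1) * A)) =
      \sum_(u | P u) \sum_(v | P v)
         (- (p / n) * (a u `^ p + (a v `^ p - (v == u)%:R * (2 * a u `^ p)))).
    under eq_bigr => u uP.
      rewrite -mulr_sumr big_split/= sumP sumrB [X in _ - X](bigD1 u uP)/= eqxx mul1r.
      rewrite [X in 2 * _ + X]big1 ?addr0; last first.
        by move=> v /andP[_ /negbTE ->]; rewrite mul0r.
      rewrite -/A; over.
    rewrite -mulr_sumr big_split/= sumrB sumP -!mulr_sumr -/A.
    ring.
  apply: ler_sum => u uP; apply: ler_sum => v vP.
  rewrite -(aP u)// -(aP v)//.
  have [->|_] := eqVneq v u.
    by rewrite subrr normr0 powR0 ?gt_eqF// mul1r; lra.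
  rewrite mul0r subr0.
  have le_pow (x y : R) : 0 <= x -> 0 <= y -> `|x - y| `^ p <= x `^ p + y `^ p.
    wlog xy : x y / y <= x => [hw x0 y0|x0 y0].
      have [xy|xy] := leP y x; first exact: hw.
      by rewrite distrC [leRHS]addrC; apply: hw => //; exact: ltW.
    apply: (@le_trans _ _ (x `^ p)); last by rewrite lerDl powR_ge0.
    rewrite ger0_norm ?subr_ge0//; apply: ge0_ler_powR; rewrite ?nnegrE ?(ltW p0)//.
      by rewrite subr_ge0.
    by rewrite gerBl.
  have := ler_wpM2r (powR_ge0 `|a u - a v| p) tp.
  have := ler_wpM2l (le_trans tp0 tp) (le_pow _ _ (a0 u) (a0 v)); lra.
have outP : \sum_(u | P u) \sum_(v | ~~ P v)
    (t `^ p * `|f u - f v| `^ p - `|a u - a v| `^ p) >=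
    p / n * ((k - 1) * A).
  rewrite mulrA mulr_sumr; apply: ler_sum => u uP.
  have au : 0 < a u by rewrite aP// -PE.
  have aup : a u `^ p = a u * a u `^ (p - 1) by rewrite mulr_powRB1.
  apply: (@le_trans _ _ (\sum_(v | ~~ P v)
     p * a u `^ (p - 1) * (t * (f u - f v) - a u))).
    rewrite -mulr_sumr sumrB -mulr_sumr sumrB NS !sumN -aP// aup.
    have -> : p / n * (k - 1) * (a u * a u `^ (p - 1)) =
      p * a u `^ (p - 1) * ((k - 1) * a u / n) by ring.
    rewrite ler_wpM2l ?mulr_ge0 ?powR_ge0 ?(ltW p0)//.
    rewrite ler_pdivrMr//.
    have -> : (t * (l * a u - - S) - l * a u) * n =
      (n - 1) * (l * a u + S) - n * (l * a u) by rewrite -tn; ring.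
    have n1 : 0 <= n - 1 by lra.
    have := ler_wpM2l n1 (a_le _ uP); rewrite nE; lra.
  apply: ler_sum => v vN; rewrite (aN v)// subr0 (ger0_norm (a0 u)).
  have d0 : 0 <= f u - f v.
    move: uP vN; rewrite !PE -leNgt; lra.
  rewrite (ger0_norm d0) -powRM ?(ltW t0)//.
  have := powR_ge_tangent p1 (mulr_ge0 (ltW t0) d0) au; lra.
apply: le_trans (lerD inP (ler_wpM2l (ler0n R 2) outP)); lra.
Qed.

(** It suffices to bound a single value, as oscillations of [f^+] are at most
    its maximum; and [n f x] is the sum of the [n - 1] differences
    [f x - f y] with [y != x]. *)
Lemma pos_part_oscillation (R : realType) (V : finType) (B : R) (f : V -> R) :
  \sum_v f v = 0 -> (forall u v, `|f u - f v| <= B) ->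
  forall u v, `|Num.max (f u) 0 - Num.max (f v) 0| <= (1 - #|V|%:R^-1) * B.
Proof.
move=> f0 fB u v.
have V0 : (0 < #|V|)%N by apply/card_gt0P; exists u.
have n0 : 0 < #|V|%:R :> R by rewrite ltr0n.
have up x : f x <= (1 - #|V|%:R^-1) * B.
  rewrite -(ler_pM2r n0) -mulrA mulrC [X in _ <= X]mulrC -mulrA mulrBr mulr1.
  rewrite divff ?gt_eqF// [B * _]mulrC.
  have -> : #|V|%:R * f x = \sum_(y | y != x) (f x - f y).
    transitivity (\sum_y (f x - f y)).
      by rewrite sumrB f0 subr0 sumr_const mulr_natl.
    by rewrite (bigD1 x)//= subrr add0r.
  apply: (@le_trans _ _ (\sum_(y | y != x) B)).
    by apply: ler_sum => y _; rewrite (le_trans (ler_norm _)).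
  by rewrite sumr_const cardC1 -[B *+ _]mulr_natl -subn1 natrB.
have : 0 <= (1 - #|V|%:R^-1) * B.
  rewrite mulr_ge0 ?(le_trans (normr_ge0 _) (fB u v))//.
  by rewrite subr_ge0 invf_le1// ler1n.
have := up u; have := up v; rewrite ler_norml.
by case: (leP (f u) 0) => ?; case: (leP (f v) 0) => ?; lra.
Qed.

(** * The maximal function and the variation on a complete graph *)

Lemma dist_complete (V : finType) (u v : complete_graph V) :
  dist u v = (u != v) :> nat.
Proof.
rewrite /dist; case: ex_minnP => k /existsP[s /andP[ps /eqP lst]] kmin.
have [uv|uv] := eqVneq u v.
  apply/eqP; rewrite -leqn0; apply: kmin; apply/existsP.
  by exists [tuple] => /=; rewrite uv.
apply/eqP; rewrite eqn_leq; apply/andP; split.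
  apply: kmin; apply/existsP; exists [tuple v] => /=.
  by rewrite eqxx !andbT; exact: uv.
rewrite lt0n; apply: contraNneq uv => k0; move: s ps lst; rewrite k0 => s _.
by rewrite (tuple0 s) /= => ->.
Qed.

Lemma hl_max_complete (R : realType) (V : finType) (f : complete_graph V -> R)
    (e : complete_graph V) :
  hl_max f e = Num.max `|f e| (#|V|%:R^-1 * \sum_v `|f v|).
Proof.
have ball_small r : 0 <= r < 1 -> ball_avg f e r = `|f e|.
  move=> /andP[r0 r1]; rewrite /ball_avg.
  have -> : gball e r = [set e]%SET.
    apply/setP => v; rewrite !inE dist_complete; have [_|_] := eqVneq e v => //=.
    by apply/negbTE; rewrite -ltNge.
  by rewrite cards1 invr1 mul1r big_set1.
have ball_large r : 1 <= r -> ball_avg f e r = #|V|%:R^-1 * \sum_v `|f v|.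
  move=> r1; rewrite /ball_avg.
  have -> : gball e r = [set: complete_graph V]%SET.
    apply/setP => v; rewrite !inE dist_complete.
    by case: (e != v) => //=; rewrite (le_trans ler01).
  by rewrite cardsT; congr (_ * _); apply: eq_bigl => v; rewrite inE.
apply/eqP; rewrite eq_le ge_max; apply/andP; split; last first.
  rewrite -(ball_small 0) ?lexx ?ltr01// -(ball_large 1)//.
  by rewrite !hl_max_ge ?ler01.
have [r r0 ->] := hl_max_attained f e; rewrite le_max.
have [r1|r1] := ltP r 1; first by rewrite ball_small ?r0// lexx.
by rewrite ball_large// lexx orbT.
Qed.

(** Diagonal pairs contribute nothing, so the adjacency condition can be
    dropped. *)
Lemma pvar_complete_fin (R : realType) (V : finType) (r : R)
    (f : complete_graph V -> R) :
  0 < r ->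
  pvar r%:E f = (2^-1 * \sum_(u : V) \sum_(v : V) `|f u - f v| `^ r) `^ r^-1.
Proof.
move=> r0 /=; congr ((_ * _) `^ _); apply: eq_bigr => u _.
rewrite [RHS](bigID (fun v => u != v))/= [X in _ + X]big1 ?addr0.
  by apply: eq_bigl => v; rewrite dist_complete eqb1.
by move=> v; rewrite negbK => /eqP->; rewrite subrr normr0 powR0 ?gt_eqF.
Qed.

Lemma pvar_complete_oo_ge (R : realType) (V : finType)
    (f : complete_graph V -> R) (u v : complete_graph V) :
  `|f u - f v| <= pvar +oo%E f.
Proof.
rewrite /pvar; have [->|uv] := eqVneq u v.
  by rewrite subrr normr0 bigmax_ge_id.
apply: (le_bigmax_cond _ (fun uv : V * V => `|f uv.1 - f uv.2|) (j := (u, v))).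
by rewrite /= dist_complete uv.
Qed.

Lemma pvar_ge0 (R : realType) (G : cgraph) (p : \bar R) (f : G -> R) :
  0 <= pvar p f.
Proof. by case: p => [r| |]//=; [exact: powR_ge0 | exact: bigmax_ge_id]. Qed.

Lemma pvar_affine (R : realType) (V : finType) (p : \bar R) (c d : R)
    (f g : complete_graph V -> R) :
  (0 < p)%E -> 0 <= c -> (forall v, g v = c * f v + d) ->
  pvar p g = c * pvar p f.
Proof.
move=> p0 c0 gE; have gB u v : `|g u - g v| = c * `|f u - f v|.
  by rewrite !gE opprD addrACA subrr addr0 -mulrBr normrM (ger0_norm c0).
case: p p0 => [r| |]//; last first.
  move=> _; rewrite /= (eq_bigr _ (fun i _ => gB i.1 i.2)).
  rewrite (big_morph (fun x : R => c * x) (id1 := 0) (op1 := Num.max)) ?mulr0//.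
  by move=> x y; rewrite maxr_pMr.
rewrite lte_fin => r0; rewrite !pvar_complete_fin//.
under eq_bigr do under eq_bigr do rewrite gB powRM//.
under eq_bigr do rewrite -mulr_sumr.
rewrite -mulr_sumr mulrCA powRM ?powR_ge0//.
  by rewrite -powRrM divff ?gt_eqF// powRr1.
by rewrite mulr_ge0// !sumr_ge0// => u _; rewrite sumr_ge0// => v _; exact: powR_ge0.
Qed.

Lemma pvar_hl_max_le (R : realType) (V : finType) (p : \bar R)
    (f : complete_graph V -> R) :
  (0 < p)%E -> (1 < #|V|)%N ->
  pvar p (hl_max f) <= (1 - #|V|%:R^-1) * pvar p f.
Proof.
move=> p0 V2; pose m := #|V|%:R^-1 * \sum_v `|f v|.
pose g v := `|f v| - m.
have n0 : 0 < #|V|%:R :> R by rewrite ltr0n ltnW.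
have t0 : 0 <= 1 - #|V|%:R^-1 :> R.
  by rewrite subr_ge0 invf_le1// ler1n ltnW.
have g0 : \sum_v g v = 0.
  rewrite sumrB sumr_const -[_ *+ #|_|]mulr_natl /m mulrA divff ?gt_eqF//.
  by rewrite mul1r subrr.
have hlB u v : `|hl_max f u - hl_max f v| =
    `|Num.max (g u) 0 - Num.max (g v) 0|.
  have hlE x : hl_max f x = Num.max (g x) 0 + m.
    by rewrite hl_max_complete -/m addr_maxl /g subrK add0r.
  by rewrite !hlE opprD addrACA subrr addr0.
have gB u v : `|g u - g v| <= `|f u - f v|.
  by rewrite /g opprB addrA subrK; exact: ler_dist_dist.
case: p p0 => [r| |]//; last first.
  move=> _; have osc := pos_part_oscillation g0
    (fun u v => le_trans (gB u v) (pvar_complete_oo_ge f u v)).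
  apply: bigmax_le; first by rewrite mulr_ge0// pvar_ge0.
  by move=> uv _; rewrite hlB osc.
rewrite lte_fin => r0; rewrite !pvar_complete_fin//.
have sum_ge0 (h : V -> V -> R) : 0 <= \sum_u \sum_v `|h u v| `^ r.
  by apply: sumr_ge0 => u _; apply: sumr_ge0 => v _; exact: powR_ge0.
have main : \sum_(u : V) \sum_(v : V) `|hl_max f u - hl_max f v| `^ r <=
    (1 - #|V|%:R^-1) `^ r * \sum_(u : V) \sum_(v : V) `|f u - f v| `^ r.
  under eq_bigr do under eq_bigr do rewrite hlB.
  apply: (@le_trans _ _ ((1 - #|V|%:R^-1) `^ r *
      \sum_(u : V) \sum_(v : V) `|g u - g v| `^ r)).
    have [r1|/ltW r1] := leP r 1.
      by apply: pos_part_variation_concave; rewrite ?r0.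
    exact: pos_part_variation_convex.
  rewrite ler_wpM2l ?powR_ge0//; apply: ler_sum => u _; apply: ler_sum => v _.
  by apply: ge0_ler_powR; rewrite ?nnegrE ?(ltW r0).
have tE : 1 - #|V|%:R^-1 = ((1 - #|V|%:R^-1) `^ r) `^ r^-1 :> R.
  by rewrite -powRrM divff ?gt_eqF// powRr1.
rewrite [X in _ <= X * _]tE -powRM.
- apply: ge0_ler_powR; rewrite ?nnegrE ?invr_ge0 ?(ltW r0) ?mulr_ge0 ?powR_ge0//.
  by rewrite mulrCA ler_pM2l.
- exact: powR_ge0.
- by rewrite mulr_ge0.
Qed.

Lemma pvar_delta_gt0 (R : realType) (V : finType) (p : \bar R)
    (a : complete_graph V) :
  (0 < p)%E -> (1 < #|V|)%N -> 0 < pvar p (delta R a).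
Proof.
move=> p0 V2.
have [b ba] : exists b : complete_graph V, b != a.
  have : (0 < #|predC1 (a : V)|)%N by rewrite cardC1 -subn1 subn_gt0.
  by move=> /card_gt0P[b]; exists b.
have dab : `|delta R a a - delta R a b| = 1.
  by rewrite /delta eqxx (negbTE ba) subr0 normr1.
case: p p0 => [r| |]//; last first.
  by move=> _; rewrite (lt_le_trans ltr01)// -dab pvar_complete_oo_ge.
rewrite lte_fin => r0; rewrite pvar_complete_fin// powR_gt0// mulr_gt0//.
rewrite (bigD1 (a : V))//= ltr_pwDl//.
  rewrite (bigD1 (b : V))//= ltr_pwDl//.
    by rewrite dab powR1.
  by apply: sumr_ge0 => v _; exact: powR_ge0.
by apply: sumr_ge0 => u _; apply: sumr_ge0 => v _; exact: powR_ge0.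
Qed.

(** The mean of [delta] is [1/n], hence [hl_max delta] is
    [(1 - 1/n) delta + 1/n]. *)
Lemma pvar_hl_max_delta (R : realType) (V : finType) (p : \bar R)
    (a : complete_graph V) :
  (0 < p)%E -> (1 < #|V|)%N ->
  pvar p (hl_max (delta R a)) = (1 - #|V|%:R^-1) * pvar p (delta R a).
Proof.
move=> p0 V2.
have n1 : #|V|%:R^-1 <= 1 :> R by rewrite invf_le1 ?ltr0n ?ler1n ltnW.
apply: (pvar_affine (d := #|V|%:R^-1)) => //; first by rewrite subr_ge0.
move=> v; rewrite hl_max_complete (bigD1 (a : V))//= big1 => [|u /negbTE ua].
  rewrite /delta eqxx normr1 addr0 mulr1; case: eqVneq => _.
    by rewrite normr1 mulr1 subrK; apply/max_idPl.
  by rewrite normr0 mulr0 add0r; apply/max_idPr; rewrite invr_ge0.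
by rewrite /delta ua normr0.
Qed.

Lemma var_const_complete (R : realType) (V : finType) (p : \bar R) :
  (0 < p)%E -> (1 < #|V|)%N ->
  var_const (complete_graph V) p = (1 - #|V|%:R^-1)%:E.
Proof.
move=> p0 V2; have /card_gt0P[a _] : (0 < #|V|)%N by exact: ltnW.
apply/eqP; rewrite eq_le; apply/andP; split.
  apply: ge_ereal_sup => _ [f /= f0 <-].
  by rewrite lee_fin ler_pdivrMr// pvar_hl_max_le.
apply: ereal_sup_ubound; exists (delta R (a : complete_graph V)).
  exact: pvar_delta_gt0.
by rewrite pvar_hl_max_delta// mulfK// gt_eqF// pvar_delta_gt0.
Qed.

Theorem theorem1 (R : realType) (p : \bar R) (n : nat) (V : finType)
    (a : 'I_n -> V) (p_gt0 : (0 < p)%E) (n_ge2 : (2 <= n)%N)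
    (a_bij : bijective a) :
  let K := complete_graph V in
  let a2 : K := a (Ordinal n_ge2) in
  let case_i := (1 < p)%E in
  let case_ii := (p <= 1)%E /\ n = 4%N in
  let case_iii := (3 <= n)%N /\ ((ln 4 / ln 6)%:E <= p <= 1)%E in
  [/\ case_i -> var_const K p = (1 - n%:R^-1)%:E,
      case_ii -> var_const K p = (1 - n%:R^-1)%:E,
      case_iii -> var_const K p = (1 - n%:R^-1)%:E
    & case_i \/ case_ii \/ case_iii ->
      (pvar p (hl_max (delta R a2)))%:E
        = (var_const K p * (pvar p (delta R a2))%:E)%E].
Proof.
have nV : #|V| = n by rewrite -(bij_eq_card a_bij) card_ord.
have V2 : (1 < #|V|)%N by rewrite nV.
move=> K a2 case_i case_ii case_iii; rewrite -nV.
have constE := var_const_complete p_gt0 V2.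
split=> // _; rewrite constE -EFinM; congr (_%:E).
exact: pvar_hl_max_delta.
Qed.
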